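(* Let $r\sim\mathcal{U}(0,1)$ and let $c$ be a random variable with values in $[0,1]$, independent of $r$, with mean $\mu$ and variance $\sigma^2$. Define $$\ell=\begin{cases} c & \text{if } c\ge r,\\ 1-c & \text{if } c<r,\end{cases}$$ and let $\mu_\ell$ and $\sigma_\ell^2$ denote the mean and variance of $\ell$. Then $$\mu_\ell=1-2(\mu-\mu^2-\sigma^2),\qquad \sigma_\ell^2=(\mu-\mu^2-\sigma^2)\bigl(1-4(\mu-\mu^2-\sigma^2)\bigr).$$ In particular, if $\mu=\tfrac12$, then $\mu_\ell=\tfrac12+2\sigma^2$ and $\sigma_\ell^2=\sigma^2(1-4\sigma^2)$.
   Context: $\mathcal{U}(0,1)$ is the uniform distribution on $(0,1)$. *)

(* Defs.v *)
From HB Require Import structures.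
From mathcomp Require Import all_boot all_order all_algebra.
From mathcomp Require Import all_classical all_reals all_analysis.
From mathcomp Require Import measurable_realfun.

Set Implicit Arguments.
Unset Strict Implicit.
Unset Printing Implicit Defensive.

Import Order.TTheory GRing.Theory Num.Theory.

Local Open Scope classical_set_scope.
Local Open Scope ring_scope.

(* Laws are compared on measurable sets only: the values of a measure on
   non-measurable sets carry no information. [uniform_prob] is the normalized
   Lebesgue measure on the closed interval [0, 1], whose endpoints are null, so
   it is the uniform law on the open interval. *)
Definition uniform01 d (T : measurableType d) (R : realType)
    (P : probability T R) (X : {RV P >-> R}) : Prop :=
  forall A : set R, measurable A ->
    distribution P X A = uniform_prob (@ltr01 R) A.

Definition independent_RV d d1 d2 (T : measurableType d)
    (T1 : measurableType d1) (T2 : measurableType d2) (R : realType)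
    (P : probability T R) (X : {RV P >-> T1}) (Y : {RV P >-> T2}) : Prop :=
  forall (A : set T1) (B : set T2), measurable A -> measurable B ->
    (P (X @^-1` A `&` Y @^-1` B) = P (X @^-1` A) * P (Y @^-1` B))%E.

Section ell.
Context d (T : measurableType d) (R : realType) (P : probability T R).
Variables (c r : {RV P >-> R}).

Definition ell (w : T) : R := if r w <= c w then c w else 1 - c w.

Let measurable_ell : measurable_fun [set: T] ell.
Proof.
apply: measurable_fun_if => //=.
- exact: measurable_fun_ler.
- exact: measurable_funTS.
- by apply: measurable_funB => //; exact: measurable_funTS.
Qed.

HB.instance Definition _ := isMeasurableFun.Build _ _ _ _ ell measurable_ell.

End ell.

(* Main.v *)
Require Import Defs.
From mathcomp Require Import all_boot all_order all_algebra.
From mathcomp Require Import all_classical all_reals all_analysis.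
From HB Require Import structures.
From mathcomp Require Import measurable_realfun ring lra.

(** Conditionally on [c = x], the event [r <= x] has probability [x], because [r]
is uniform and independent of [c]. Hence [ell] takes the value [x] with
probability [x] and the value [1 - x] with probability [1 - x], so that
    E[phi(ell)] = E[c phi(c) + (1 - c) phi(1 - c)]
for every test function [phi >= 0]; this is [ge0_expectation_ell]. The
conditioning is made rigorous by Tonelli's theorem: independence says that the
law of [(c, r)] is the product of the laws ([independent_joint_law]), and the
inner integral over [r] is the integral of a two-valued step function
([uniform01_integral_step]).

Put [m = mu - mu^2 - sigma^2 = E[c(1 - c)]]. With [phi(x) = |x|] and
[phi(x) = x^2] the formula only involves polynomials of degree 2 in [c]:
    c^2 + (1 - c)^2 = 1 - 2c(1 - c),    c^3 + (1 - c)^3 = 1 - 3c(1 - c),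
the cubic terms of the second one cancelling. So the mean of [ell] is [1 - 2m],
its second moment is [1 - 3m], and its variance is
[1 - 3m - (1 - 2m)^2 = m(1 - 4m)]. If [mu = 1/2] then [m = 1/4 - sigma^2]. *)

Import Order.TTheory GRing.Theory Num.Theory.

Local Open Scope classical_set_scope.
Local Open Scope ring_scope.

Set Implicit Arguments.
Unset Strict Implicit.

Section independence.
Context d d1 d2 (T : measurableType d) (T1 : measurableType d1)
  (T2 : measurableType d2) (R : realType) (P : probability T R).
Variables (X : {RV P >-> T1}) (Y : {RV P >-> T2}).

Definition joint (w : T) : T1 * T2 := (X w, Y w).

Let measurable_joint : measurable_fun [set: T] joint.
Proof. by apply: measurable_fun_pair. Qed.

HB.instance Definition _ :=
  isMeasurableFun.Build _ _ _ _ joint measurable_joint.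

(** Product measures of sigma-finite measures are determined by their values on
rectangles, and on rectangles the claim is independence. *)
Lemma independent_joint_law : independent_RV X Y ->
  forall A : set (T1 * T2), measurable A ->
    distribution P joint A = (distribution P X \x distribution P Y)%E A.
Proof.
move=> XY A mA; apply/esym; move: A mA.
by apply: product_measure_unique => A B mA mB; rewrite -XY.
Qed.

(** Integrating against a function of an independent pair may be done one variable
at a time. The outer integral is kept over the sample space rather than over
the law of [X], so that pointwise bounds on [X] remain usable. *)
Lemma independent_ge0_integral (f : T1 * T2 -> \bar R) :
    independent_RV X Y -> measurable_fun [set: T1 * T2] f ->
    (forall z, (0 <= f z)%E) ->
  (\int[P]_w f (X w, Y w) = \int[P]_w \int[distribution P Y]_y f (X w, y))%E.
Proof.
move=> XY mf f0.
transitivity (\int[distribution P joint]_z f z)%E.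
  by rewrite ge0_integral_distribution.
transitivity (\int[(distribution P X \x distribution P Y)%E]_z f z)%E.
  apply: eq_measure_integral => A mA _; exact: (independent_joint_law XY mA).
rewrite fubini_tonelli1//.
rewrite (ge0_integral_distribution X (f := fubini_F (distribution P Y) f))//.
  exact: measurable_fun_fubini_tonelli_F.
by move=> x; apply: integral_ge0.
Qed.

End independence.

Lemma uniform01_itvNyc d (T : measurableType d) (R : realType)
    (P : probability T R) (r : {RV P >-> R}) (x : R) :
  uniform01 r -> 0 <= x <= 1 -> distribution P r `]-oo, x] = x%:E.
Proof.
move=> ru /andP[x0 x1]; rewrite ru// /uniform_prob integral_uniform_pdf.
have -> : `]-oo, x] `&` `[0, 1] = `[0, x]%classic :> set R.
  apply/seteqP; split=> y /=; rewrite !in_itv/=.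
    by move=> [yx /andP[-> _]].
  by move=> /andP[-> yx]; split => //; exact: le_trans yx x1.
rewrite (eq_integral (cst 1%E)).
  rewrite integral_cst//= mul1e lebesgue_measure_itv/= lte_fin.
  have [_|] := ltP 0 x; first by rewrite -EFinB subr0.
  by move=> x0'; have -> : x = 0 by apply/eqP; rewrite eq_le x0 x0'.
move=> y; rewrite inE/= in_itv/= => /andP[y0 yx].
by rewrite /uniform_pdf y0 (le_trans yx x1) subr0 invr1.
Qed.

(** This is E[phi(ell)] given [c = x], with [a] and [b] the values of [phi] at [x]
and [1 - x]. *)
Lemma uniform01_integral_step d (T : measurableType d) (R : realType)
    (P : probability T R) (r : {RV P >-> R}) (x a b : R) :
    uniform01 r -> 0 <= x <= 1 -> 0 <= a -> 0 <= b ->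
  (\int[distribution P r]_y (if y <= x then a else b)%:E)%E =
  (x * a + (1 - x) * b)%:E.
Proof.
move=> ru x01 a0 b0.
have mx : measurable (`]-oo, x] : set R) by [].
rewrite -(setvU `]-oo, x]) ge0_integral_setU//=; first last.
- by apply/disj_setPS; rewrite setICl.
- by move=> y _; rewrite lee_fin; case: ifP.
- apply/measurable_EFinP; apply: measurable_funTS.
  by apply: measurable_fun_if => //=; exact: measurable_fun_ler.
- exact: measurableC.
rewrite (eq_integral (cst b%:E)); last first.
  by move=> y; rewrite inE/= in_itv/= => /negP/negbTE ->.
rewrite [X in (_ + X)%E](eq_integral (cst a%:E)); last first.
  by move=> y; rewrite inE/= in_itv/= => ->.
rewrite !integral_cst//=; last exact: measurableC.
have cdf_x := uniform01_itvNyc ru x01.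
have -> : distribution P r (~` `]-oo, x]) = (1 - x)%:E.
  by rewrite probability_setC// EFinB; congr (_ - _)%E.
by rewrite cdf_x -!EFinM -EFinD addrC mulrC [b * _]mulrC.
Qed.

(** The law of [ell] is the mixture, over the values of [c], of the two-point laws
giving mass [c] to [c] and mass [1 - c] to [1 - c]. Nonnegativity of [phi] makes
Tonelli's theorem applicable without an integrability condition. *)
Lemma ge0_expectation_ell d (T : measurableType d) (R : realType)
    (P : probability T R) (c r : {RV P >-> R}) (phi : R -> R) :
    uniform01 r -> (forall w, 0 <= c w <= 1) -> independent_RV c r ->
    measurable_fun [set: R] phi -> (forall x, 0 <= phi x) ->
  ('E_P[phi \o ell c r] =
   'E_P[fun w => (c w * phi (c w) + (1 - c w) * phi (1 - c w))%R])%E.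
Proof.
move=> ru c01 cr mphi phi0; rewrite unlock.
pose f (z : R * R) := (if z.2 <= z.1 then phi z.1 else phi (1 - z.1))%:E.
transitivity (\int[P]_w f (c w, r w))%E.
  by apply: eq_integral => w _; rewrite /f /ell /=; case: ifP.
rewrite (independent_ge0_integral cr)//.
- apply: eq_integral => w _.
  by rewrite /f/= (uniform01_integral_step ru).
- apply/measurable_EFinP; apply: measurable_fun_if => //=.
  + exact: measurable_fun_ler.
  + by apply: measurable_funTS; apply: measurableT_comp.
  + apply: measurable_funTS; apply: measurableT_comp => //.
    exact: measurable_funB.
- by move=> z; rewrite lee_fin /f; case: ifP.
Qed.

Section unit_interval_valued.
Context d (T : measurableType d) (R : realType) (P : probability T R).
Variable X : {RV P >-> R}.
Hypothesis X01 : forall w, 0 <= X w <= 1.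

Let bounded_Lfun1 (Y : T -> R) : measurable_fun [set: T] Y ->
  (forall w, 0 <= Y w <= 1) -> Y \in Lfun P 1.
Proof.
move=> mY Y01; apply/Lfun1_integrable.
apply: measurable_bounded_integrable => //.
  by apply: le_lt_trans (probability_le1 P _) (ltry _).
exists 1; split=> // M M1 w _ /=; apply: le_trans (ltW M1).
by have /andP[Y0 Y1] := Y01 w; rewrite ger0_norm.
Qed.

Lemma Lfun1_unit_interval : (X : T -> R) \in Lfun P 1.
Proof. exact: bounded_Lfun1. Qed.

Lemma Lfun1_sqr_unit_interval : (X : T -> R) ^+ 2 \in Lfun P 1.
Proof.
apply: bounded_Lfun1 => [|w]; first exact: measurable_funM.
have -> : ((X : T -> R) ^+ 2) w = X w ^+ 2 by [].
by have /andP[X0 X1] := X01 w; rewrite exprn_ge0//= exprn_ile1.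
Qed.

(** Boundedness supplies the finite second moment needed to expand the variance. *)
Lemma variance_unit_interval :
  ('V_P[X] = 'E_P[(X : T -> R) ^+ 2] - 'E_P[X] ^+ 2)%E.
Proof.
rewrite /variance covarianceE//; [exact: Lfun1_unit_interval..|].
exact: Lfun1_sqr_unit_interval.
Qed.

Lemma expectation_quadratic (a b e : R) :
  ('E_P[fun w => (a + b * X w + e * X w ^+ 2)%R] =
   a%:E + b%:E * 'E_P[X] + e%:E * 'E_P[(X : T -> R) ^+ 2])%E.
Proof.
have L1 := Lfun1_unit_interval; have L2 := Lfun1_sqr_unit_interval.
have La : cst a \in Lfun P 1 by exact: Lfun_cst.
have LZ k (Y : T -> R) : Y \in Lfun P 1 -> k \o* Y \in Lfun P 1.
  exact: Lfun_scale.
have -> : (fun w => a + b * X w + e * X w ^+ 2) =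
    (cst a \+ b \o* X) \+ e \o* ((X : T -> R) ^+ 2).
  by apply/funext => w /=; rewrite [X w * b]mulrC; congr (_ + _); exact: mulrC.
rewrite !expectationD ?expectationZl ?expectation_cst ?LZ//.
by rewrite rpredD ?LZ.
Qed.

End unit_interval_valued.

Unset Implicit Arguments.

Theorem corollary6 (d : measure_display) (T : measurableType d) (R : realType)
    (P : probability T R) (c r : {RV P >-> R}) (mu sigma : R)
    (r_unif : uniform01 r)
    (c_01 : forall w : T, 0 <= c w <= 1)
    (c_r_indep : independent_RV c r)
    (c_mean : 'E_P[c]%E = mu%:E)
    (c_var : 'V_P[c]%E = (sigma ^+ 2)%:E) :
  [/\ 'E_P[ell c r]%E = (1 - 2 * (mu - mu ^+ 2 - sigma ^+ 2))%:E,
      'V_P[ell c r]%E = ((mu - mu ^+ 2 - sigma ^+ 2) *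
                         (1 - 4 * (mu - mu ^+ 2 - sigma ^+ 2)))%:E
    & mu = 1 / 2 ->
      'E_P[ell c r]%E = (1 / 2 + 2 * sigma ^+ 2)%:E /\
      'V_P[ell c r]%E = (sigma ^+ 2 * (1 - 4 * sigma ^+ 2))%:E].
Proof.
have l01 w : 0 <= ell c r w <= 1.
  by rewrite /ell; have := c_01 w; case: ifP => _ /andP[? ?]; lra.
pose m := mu - mu ^+ 2 - sigma ^+ 2.
have c2 : ('E_P[(c : T -> R) ^+ 2] = (mu ^+ 2 + sigma ^+ 2)%:E)%E.
  have := c_var; rewrite (variance_unit_interval c_01) c_mean -EFin_expe.
  have : 'E_P[(c : T -> R) ^+ 2]%E \is a fin_num.
    exact/expectation_fin_num/Lfun1_sqr_unit_interval.
  by case: ('E_P[(c : T -> R) ^+ 2]%E) => // x _ [?]; congr EFin; lra.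
have El : 'E_P[ell c r]%E = (1 - 2 * m)%:E.
  (* The identity is not a nonnegative test function, but it agrees with the
     absolute value on the values of [ell]. *)
  transitivity ('E_P[(fun x : R => `|x|)%R \o ell c r])%E.
    congr expectation; apply/funext => w /=.
    by have /andP[l0 _] := l01 w; rewrite ger0_norm.
  rewrite ge0_expectation_ell//.
  transitivity 'E_P[fun w => (1 + (- 2) * c w + 2 * c w ^+ 2)%R]%E.
    congr expectation; apply/funext => w.
    by have /andP[? ?] := c_01 w; rewrite !ger0_norm ?subr_ge0//; ring.
  rewrite (expectation_quadratic c_01) c2 c_mean.
  by rewrite -!EFinM -!EFinD; congr EFin; rewrite /m; ring.
have El2 : 'E_P[(ell c r : T -> R) ^+ 2]%E = (1 - 3 * m)%:E.
  transitivity ('E_P[(fun x : R => x ^+ 2)%R \o ell c r])%E; first by [].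
  rewrite ge0_expectation_ell//; last by move=> x; exact: sqr_ge0.
  transitivity 'E_P[fun w => (1 + (- 3) * c w + 3 * c w ^+ 2)%R]%E.
    by congr expectation; apply/funext => w; ring.
  rewrite (expectation_quadratic c_01) c2 c_mean.
  by rewrite -!EFinM -!EFinD; congr EFin; rewrite /m; ring.
have Vl : 'V_P[ell c r]%E = (m * (1 - 4 * m))%:E.
  rewrite (variance_unit_interval l01) El El2 -EFin_expe -EFinB.
  by congr EFin; ring.
split=> // mu2; rewrite El Vl /m mu2.
by split; congr EFin; field.
Qed.
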